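(* (Decomposition Lemma) Let $0\le\gamma<10^{-4}$, $\alpha\ge1$, and let $a\in\mathcal P$ satisfy $\mathrm{LB}(a)\le(0.5+\gamma)\cdot\mathrm{LP}(a)$. Then there exists $\tilde a=(\tilde a_{it})_{i\in U,t\in V}$ with non-negative entries such that - $\tilde a_{it}\le a_{it}$ for all $(i,t)$; - $\mathrm{LP}(\tilde a)\ge(1-\gamma^{1/4})\cdot\mathrm{LP}(a)$; and, furthermore, for every $i\in U$, letting $\tilde a^L_{it}=\tilde a_{it}\cdot\mathbf 1[w_{it}>\alpha\cdot\mathrm{LP}_i(\tilde a)]$, - $\sum_t\tilde a^L_{it}\le\gamma^{1/4}$; - $(0.5-(\alpha+2)\gamma^{1/4})\cdot\mathrm{LP}_i(\tilde a)\le\mathrm{LP}_i(\tilde a^L)\le(0.5+\gamma^{1/4})\cdot\mathrm{LP}_i(\tilde a)$.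
   Context: $U$ and $V$ are finite sets (offline and online vertices), $w_{it}\ge0$ are weights and $p_t\in[0,1]$ probabilities for $i\in U$, $t\in V$. $\mathcal P$ is the set of $x=(x_{it})_{i\in U,t\in V}$ with $x_{it}\ge0$, $\sum_{i\in U}x_{it}\le p_t$ for all $t\in V$, and $\sum_{t\in V}x_{it}\le1$ for all $i\in U$. For $x\in\mathcal P$, $\mathrm{LP}_i(x)=\sum_{t\in V} w_{it}x_{it}$, $\mathrm{LP}(x)=\sum_{i\in U}\mathrm{LP}_i(x)$, $$\mathrm{LB}_i(x)=\max_{\tau\ge 0}\ \sum_{t:\ w_{it}\ge\tau}\ \Big(\prod_{s:\ \tau\le w_{is}<w_{it}}(1-x_{is})\Big)\, x_{it}\, w_{it},$$ and $\mathrm{LB}(x)=\sum_{i\in U}\mathrm{LB}_i(x)$. *)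

(* Defs.v *)
From HB Require Import structures.
From mathcomp Require Import all_boot all_order all_algebra.
From mathcomp Require Import boolp classical_sets reals exp.

Set Implicit Arguments.
Unset Strict Implicit.
Unset Printing Implicit Defensive.

Import Order.TTheory GRing.Theory Num.Theory.
Local Open Scope ring_scope.

Section Defs.
Variables (R : realType) (U V : finType).
Implicit Types (w x : U -> V -> R) (p : V -> R) (i : U).

Definition in_polytope p x : Prop :=
  [/\ forall i t, 0 <= x i t,
      forall t, \sum_i x i t <= p t
    & forall i, \sum_t x i t <= 1].

Definition LPi w x i : R := \sum_t w i t * x i t.

Definition LP w x : R := \sum_i LPi w x i.

Definition threshold_value w x i (tau : R) : R :=
  \sum_(t | tau <= w i t)
    (\prod_(s | (tau <= w i s) && (w i s < w i t)) (1 - x i s)) * x i t * w i t.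

(* A supremum over all real [tau >= 0]; it is a maximum, see [LBi_max]. *)
Definition LBi w x i : R :=
  sup [set threshold_value w x i tau | tau in [set tau : R | 0 <= tau]]%classic.

Definition LB w x : R := \sum_i LBi w x i.

Definition large w (alpha : R) x : U -> V -> R :=
  fun i t => x i t * (w i t > alpha * LPi w x i)%R%:R.

Lemma LBi_max w x i :
  (exists2 tau, 0 <= tau & LBi w x i = threshold_value w x i tau) /\
  (forall tau, 0 <= tau -> threshold_value w x i tau <= LBi w x i).
Proof.
pose F (S : {set V}) := \sum_(t in S)
  (\prod_(s | (s \in S) && (w i s < w i t)) (1 - x i s)) * x i t * w i t.
pose above (tau : R) : {set V} := [set t | tau <= w i t].
have FE tau : threshold_value w x i tau = F (above tau).
  apply: eq_big => [t|t _]; first by rewrite inE.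
  by congr (_ * _ * _); apply: eq_bigl => s; rewrite inE.
pose P S := `[< exists2 tau, 0 <= tau & S = above tau >].
have P0 : P (above 0) by apply/asboolP; exists 0.
have [S /asboolP[tau tau0 SE] Smax] := arg_maxP F P0.
have ubF t : 0 <= t -> threshold_value w x i t <= F S.
  by move=> t0; rewrite FE; apply: Smax; apply/asboolP; exists t.
have LBE : LBi w x i = F S.
  apply/eqP; rewrite eq_le; apply/andP; split.
    apply: ge_sup; first by exists (F S); exists tau => //; rewrite FE SE.
    by move=> _ [t t0 <-]; exact: ubF.
  apply: ub_le_sup; first by exists (F S) => _ [t t0 <-]; exact: ubF.
  by exists tau => //; rewrite FE SE.
by rewrite LBE; split=> //; exists tau => //; rewrite FE SE.
Qed.

End Defs.

(* Main.v *)
(* Write e = gamma^(1/4). Since LB_i >= LP_i/2 always, the vertices i with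
   LB_i > (1/2 + e^3) LP_i carry at most an e-fraction of LP(a): zero out their
   rows and keep all the other rows unchanged. For a remaining row put
   c = (1/2 + e^3) LP_i, sort the weights in decreasing order and let G_k be the
   value obtained from the k heaviest, so that
     G_k = x_k w_k + (1 - x_k) G_(k-1) <= LB_i <= c.
   Summing x_k w_k = (G_k - G_(k-1)) + x_k G_(k-1) turns the deficits
   D_k = c - G_k >= 0 into the exact budget
     D_n + sum_k x_k D_(k-1) = c (1 + sum_k x_k) - LP_i <= 2 e^3 LP_i.
   The recursion gives D_(k-1) >= D_k + x_k (w_k - c) while w_k >= c, hence
     sum_j M_j x_j (w_j - c)^+ <= 2 e^3 LP_i,  M_j = x_1 + ... + x_j.
   This forces the mass above LP_i to be at most e, and the excess over c of the
   weights between c and alpha LP_i to be small; the large part is therefore what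
   the weights near LP_i/2 leave over, about one half. *)
Require Import Defs.
From HB Require Import structures.
From mathcomp Require Import all_boot all_order all_algebra.
From mathcomp Require Import boolp classical_sets reals exp.
From mathcomp Require Import lra.

Set Implicit Arguments.
Unset Strict Implicit.
Unset Printing Implicit Defensive.

Import Order.TTheory GRing.Theory Num.Theory.
Local Open Scope ring_scope.

(** * Stopping values, mass and energy on weight-sorted lists *)

Section SortedSequences.
Variables (R : realFieldType) (T : Type) (w x : T -> R).
Hypothesis x01 : forall t, 0 <= x t <= 1.
Implicit Types (s : seq T) (c : R).

Let byw : rel T := relpre w <=%R.

Let byw_trans : transitive byw.
Proof. by move=> t u v; apply: le_trans. Qed.

(* Lists are sorted by increasing weight, so a tail collects the heaviest
   elements; [s'] below is what remains after its lightest element [t]. *)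
Fixpoint stop_value s : R :=
  if s is t :: s' then x t * w t + (1 - x t) * stop_value s' else 0.

Definition mass s : R := \sum_(t <- s) x t.

Definition value s : R := \sum_(t <- s) w t * x t.

(** This is [sum_j M_j x_j (w_j - c)^+]; for the element [t], the factor [x t + mass s'] is its
    [M_j]. *)
Fixpoint energy c s : R :=
  if s is t :: s' then
    energy c s' + x t * (x t + mass s') * Num.max 0 (w t - c)
  else 0.

Lemma mass_cons t s : mass (t :: s) = x t + mass s.
Proof. exact: big_cons. Qed.

Lemma value_cons t s : value (t :: s) = w t * x t + value s.
Proof. exact: big_cons. Qed.

Lemma mass_ge0 s : 0 <= mass s.
Proof. by apply: sumr_ge0 => t _; case/andP: (x01 t). Qed.

Lemma energy_step_ge0 c t s : 0 <= x t * (x t + mass s) * Num.max 0 (w t - c).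
Proof.
have /andP[x0 _] := x01 t; have := mass_ge0 s => m0.
by rewrite !mulr_ge0 ?addr_ge0 ?le_max ?lexx.
Qed.

Lemma sorted_cons_ge t s b : sorted byw (t :: s) -> b <= w t ->
  all (fun u => b <= w u) (t :: s).
Proof.
rewrite /= path_sortedE // => /andP[ts _] bt; rewrite bt /=.
by apply: sub_all ts => u; apply: le_trans.
Qed.

Lemma sorted_cons_gt t s b : sorted byw (t :: s) -> b < w t ->
  all (fun u => b < w u) (t :: s).
Proof.
rewrite /= path_sortedE // => /andP[ts _] bt; rewrite bt /=.
by apply: sub_all ts => u; apply: lt_le_trans.
Qed.

Lemma stop_value_cat s s' : all (fun t => stop_value s' <= w t) s ->
  stop_value s' <= stop_value (s ++ s').
Proof.
elim: s => //= t s IH /andP[wt /IH le_s].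
have /andP[x0 x1] := x01 t.
have := ler_wpM2l x0 wt; have : 0 <= 1 - x t by rewrite subr_ge0.
by move=> /ler_wpM2l/(_ _ _ le_s); lra.
Qed.

(** Only an inequality because of ties: unrolling the recursion multiplies by [1 - x u] for equal
    weights too, while the strict filter drops these factors, which are at most 1. *)
Lemma stop_value_le_sum s : (forall t, 0 <= w t) -> sorted byw s ->
  stop_value s <=
  \sum_(t <- s) (\prod_(u <- s | w u < w t) (1 - x u)) * x t * w t.
Proof.
move=> w0; elim: s => [|t s IH] srt; first by rewrite big_nil.
have prod_ge0 (v : T) : 0 <= \prod_(u <- s | w u < w v) (1 - x u).
  by apply: prodr_ge0 => u _; rewrite subr_ge0; case/andP: (x01 u).
have tmin : all (fun u => w t <= w u) (t :: s) by apply: sorted_cons_ge.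
rewrite big_cons /=; apply: lerD.
  suff -> : \prod_(u <- t :: s | w u < w t) (1 - x u) = 1 by rewrite mul1r.
  apply: big_hasC; rewrite -all_predC.
  by apply: sub_all tmin => u /=; rewrite -leNgt.
have /andP[x0 x1] := x01 t.
apply: (le_trans (ler_wpM2l _ (IH (path_sorted srt)))).
  by rewrite subr_ge0.
rewrite mulr_sumr; apply: ler_sum => v _.
have /andP[xv0 _] := x01 v.
rewrite 2!mulrA !ler_wpM2r // big_cons; case: ifP => // _.
by rewrite ler_piMl // lerBlDr lerDl.
Qed.

Section Capped.
Variable c : R.

Definition capped s := forall k, stop_value (drop k s) <= c.

Lemma capped_head s : capped s -> stop_value s <= c.
Proof. by move/(_ 0%N); rewrite drop0. Qed.

Lemma capped_behead t s : capped (t :: s) -> capped s.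
Proof. by move=> cap k; have := cap k.+1. Qed.

Lemma capped_c_ge0 s : capped s -> 0 <= c.
Proof. by move/(_ (size s)); rewrite drop_size. Qed.

Lemma value_le_stop_value s : capped s ->
  value s <= stop_value s + c * mass s.
Proof.
elim: s => [|t s IH] cap; first by rewrite /value /mass !big_nil /=; lra.
have cap_s := capped_behead cap; have := IH cap_s.
have /andP[x0 _] := x01 t.
have := ler_wpM2l x0 (capped_head cap_s).
rewrite value_cons mass_cons /=; lra.
Qed.

(** By sortedness the filtered list is a suffix, so the cap applies to it. *)
Lemma value_filter_le b s : sorted byw s -> capped s ->
  value [seq t <- s | b < w t] <= c * (1 + mass [seq t <- s | b < w t]).
Proof.
elim: s => [|t s IH] srt cap.
  by rewrite /value /mass !big_nil addr0 mulr1; apply: capped_c_ge0 cap.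
case: (ltP b (w t)) => bt.
  rewrite (all_filterP (sorted_cons_gt srt bt)).
  have := value_le_stop_value cap; have := capped_head cap; lra.
rewrite /= ltNge bt /=; apply: IH; first exact: path_sorted srt.
exact: capped_behead cap.
Qed.

(* Adding [t] lowers the deficit by at least [x t * (w t - c)]; the factor
   [1 + mass s] turns this drop into the increase of the energy. *)
Lemma energy_bound_above s : all (fun t => c <= w t) s -> capped s ->
  energy c s + (c - stop_value s) * (1 + mass s) <= c * (1 + mass s) - value s.
Proof.
elim: s => [|t s IH] /=; first by rewrite /value /mass !big_nil; lra.
move=> /andP[ct all_s] cap; have cap_s := capped_behead cap.
have := IH all_s cap_s; rewrite mass_cons value_cons max_r ?subr_ge0 //.
have /andP[x0 _] := x01 t; have m0 := mass_ge0 s.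
have : 0 <= x t * (x t + mass s) * (c - stop_value s).
  by rewrite mulr_ge0 ?subr_ge0 ?capped_head // mulr_ge0 ?addr_ge0.
lra.
Qed.

(** An element lighter than [c] adds no energy and raises the right side by [x t * (c - w t)], so
    only the suffix of weights at least [c] matters. *)
Lemma energy_bound s : sorted byw s -> capped s ->
  energy c s <= c * (1 + mass s) - value s.
Proof.
elim: s => [|t s IH] srt cap.
  by rewrite /value /mass !big_nil /=; have := capped_c_ge0 cap; lra.
case: (leP c (w t)) => ct.
  apply: le_trans (energy_bound_above (sorted_cons_ge srt ct) cap).
  by rewrite lerDl mulr_ge0 ?subr_ge0 ?capped_head // addr_ge0 ?mass_ge0.
have := IH (path_sorted srt) (capped_behead cap).
have /andP[x0 _] := x01 t; have := ler_wpM2l x0 (ltW ct).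
rewrite mass_cons value_cons /= max_l ?mulr0; lra.
Qed.

(** Telescoping [(m + x)^2 - m^2 <= 2 x (x + m)] along the heavy suffix, where [w t - c] is at least
    [l - c]. *)
Lemma mass_filter_energy l b s : sorted byw s -> c <= l -> l <= b ->
  (l - c) * mass [seq t <- s | b < w t] ^+ 2 <= 2%:R * energy c s.
Proof.
move=> srt cl lb; elim: s srt => [|t s IH] srt.
  by rewrite /mass big_nil expr0n /= !mulr0.
have {}IH := IH (path_sorted srt).
case: (ltP b (w t)) => bt; last first.
  by rewrite /= ltNge bt /=; have := energy_step_ge0 c t s; lra.
have all_ts := sorted_cons_gt srt bt; rewrite (all_filterP all_ts) mass_cons /=.
have /andP[_ /all_filterP fs] := all_ts; rewrite fs in IH.
have /andP[x0 _] := x01 t; have m0 := mass_ge0 s.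
rewrite max_r; last by lra.
have : 0 <= x t * (x t + mass s) by rewrite mulr_ge0 ?addr_ge0.
have le_wl : l - c <= w t - c by lra.
move/ler_wpM2l => /(_ _ _ le_wl).
have : 0 <= (l - c) * x t ^+ 2 by rewrite mulr_ge0 ?sqr_ge0 ?subr_ge0.
lra.
Qed.

(** Once the cumulative mass reaches [eta], the energy pays for the excess; before that, each excess
    is at most [b - c] and the mass involved at most [eta]. *)
Lemma excess_le b eta s : 0 <= eta -> c <= b ->
  eta * \sum_(t <- s | w t <= b) Num.max 0 (w t - c) * x t <=
  energy c s + eta * (b - c) * Num.min (mass s) eta.
Proof.
move=> eta0 cb; elim: s => [|t s IH].
  by rewrite big_nil mulr0 /mass big_nil min_l // mulr0 addr0.
rewrite big_cons mass_cons /=.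
have /andP[x0 _] := x01 t; have m0 := mass_ge0 s.
have mono : Num.min (mass s) eta <= Num.min (x t + mass s) eta.
  by rewrite le_min !ge_min lexx orbT andbT lerDr x0.
have K0 : 0 <= eta * (b - c) by rewrite mulr_ge0 ?subr_ge0.
have := ler_wpM2l K0 mono; have := energy_step_ge0 c t s.
case: ifP => [wb|_]; last by lra.
set y := Num.max 0 _.
have y0 : 0 <= y by rewrite le_max lexx.
have yb : y <= b - c by rewrite ge_max lerD2r wb subr_ge0 cb.
have xy0 : 0 <= x t * y by rewrite mulr_ge0.
case: (leP eta (x t + mass s)) => em.
  by have := ler_wpM2l xy0 em; lra.
have : eta * x t * y <= eta * x t * (b - c) by rewrite ler_wpM2l ?mulr_ge0.
rewrite /= (min_l (_ : mass s <= eta)) in IH *; lra.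
Qed.

End Capped.
End SortedSequences.

(** * A single offline vertex: [LBi] caps the sorted list *)

Section OfflineVertex.
Variables (R : realType) (U V : finType) (w x : U -> V -> R) (i : U).
Hypothesis w_ge0 : forall t, 0 <= w i t.
Hypothesis x_ge0 : forall t, 0 <= x i t.
Hypothesis x_sum : \sum_t x i t <= 1.

Let x01 t : 0 <= x i t <= 1.
Proof.
rewrite x_ge0 (le_trans _ x_sum) // (bigD1 t) //= lerDl.
by apply: sumr_ge0.
Qed.

Let byw : rel V := relpre (w i) <=%R.

Let s := sort byw (enum V).

Let perm_s : perm_eq s (index_enum V).
Proof. by rewrite perm_sort enumT. Qed.

Let s_sorted : sorted byw s.
Proof. by apply: sort_sorted => t u; apply: le_total. Qed.

Lemma stop_value_threshold_value tau :
  stop_value (w i) (x i) [seq t <- s | tau <= w i t] <= threshold_value w x i tau.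
Proof.
apply: le_trans (stop_value_le_sum x01 w_ge0 _) _.
  by apply: sorted_filter => // t u v; apply: le_trans.
rewrite big_filter (perm_big _ perm_s) /=.
apply: ler_sum => t _.
by rewrite big_filter_cond (perm_big _ perm_s).
Qed.

Lemma LBi_ge0 : 0 <= LBi w x i.
Proof.
have [_ /(_ 0 (lexx 0))] := LBi_max w x i; apply: le_trans.
apply: sumr_ge0 => t _; rewrite !mulr_ge0 //.
by apply: prodr_ge0 => u _; rewrite subr_ge0; case/andP: (x01 u).
Qed.

(* A list suffix may cut a block of equal weights, so it need not be the level
   set of a threshold; the value is monotone along the block, so completing it or
   leaving it out does at least as well. *)
Lemma capped_LBi : capped (w i) (x i) (LBi w x i) s.
Proof.
suff H s2 s1 : s = s1 ++ s2 -> stop_value (w i) (x i) s2 <= LBi w x i.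
  by move=> k; apply: (H _ (take k s)); rewrite cat_take_drop.
elim: s2 s1 => [|t s2 IH] s1 sE /=; first exact: LBi_ge0.
have {}IH : stop_value (w i) (x i) s2 <= LBi w x i.
  by apply: (IH (rcons s1 t)); rewrite cat_rcons.
have /andP[x0 x1] := x01 t; have x1' : 0 <= 1 - x i t by rewrite subr_ge0.
case: (leP (w i t) (stop_value (w i) (x i) s2)) => [wt|/ltW wt].
  by have := ler_wpM2l x0 wt; lra.
have [_ /(_ _ (w_ge0 t))] := LBi_max w x i; apply: le_trans.
apply: le_trans (stop_value_threshold_value _).
have srt : sorted (relpre (w i) <=%R) (t :: s2).
  by move: s_sorted; rewrite sE => /cat_sorted2[].
rewrite sE filter_cat (all_filterP (sorted_cons_ge srt (lexx _))).
apply: (stop_value_cat x01 (s' := t :: s2)); apply: sub_all (filter_all _ _) => u.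
apply: le_trans; have := ler_wpM2l x1' wt; rewrite /=; lra.
Qed.

Let l := LPi w x i.

Let mass_s : mass (x i) s = \sum_t x i t.
Proof. exact: perm_big. Qed.

Let value_s : value (w i) (x i) s = l.
Proof. exact: perm_big. Qed.

Lemma LPi_ge0 : 0 <= l.
Proof. by apply: sumr_ge0 => t _; rewrite mulr_ge0. Qed.

(** With [LBi] itself as the cap, both the stopping value and the cap times the mass are at most
    [LBi]. *)
Lemma half_LPi_le_LBi : l / 2%:R <= LBi w x i.
Proof.
have := value_le_stop_value x01 capped_LBi; rewrite value_s mass_s.
have := capped_head capped_LBi; have := ler_wpM2l LBi_ge0 x_sum.
lra.
Qed.

(** * A vertex with nearly tight [LBi]: mass and value of its large part *)

Variables (alpha e : R).
Hypothesis alpha_ge1 : 1 <= alpha.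
Hypothesis e_ge0 : 0 <= e.
Hypothesis e_le : e <= 1 / 10%:R.
Hypothesis l_gt0 : 0 < l.
Hypothesis LBi_le : LBi w x i <= (1 / 2%:R + e ^+ 3) * l.

Let c := (1 / 2%:R + e ^+ 3) * l.

Let s_capped : capped (w i) (x i) c s.
Proof. by move=> k; apply: le_trans LBi_le; apply: capped_LBi. Qed.

Let e2_le : e ^+ 2 <= e / 10%:R.
Proof. by rewrite expr2 ler_wpM2l // -[_^-1]mul1r. Qed.

Let e3_le : e ^+ 3 <= e ^+ 2 / 10%:R.
Proof. by rewrite exprSr ler_wpM2l ?sqr_ge0 // -[_^-1]mul1r. Qed.

Let energy_s : energy (w i) (x i) c s <= 2%:R * e ^+ 3 * l.
Proof.
have := energy_bound x01 s_sorted s_capped; rewrite value_s mass_s.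
have c0 : 0 <= c := capped_c_ge0 s_capped.
have := ler_wpM2l c0 x_sum; rewrite /c; lra.
Qed.

Let c_le : c <= l.
Proof.
rewrite /c -[leRHS]mul1r ler_wpM2r ?(ltW l_gt0) //.
have := e2_le; have := e3_le; have := e_le. lra.
Qed.

Let l_le : l <= alpha * l.
Proof. by rewrite ler_peMl // ltW. Qed.

Let large_s := [seq t <- s | alpha * l < w i t].

Let mass_large : \sum_t large w alpha x i t = mass (x i) large_s.
Proof.
rewrite /mass big_filter (perm_big _ perm_s) [RHS]big_mkcond.
by apply: eq_bigr => t _; rewrite /large; case: ifP; rewrite ?mulr1 ?mulr0.
Qed.

Let value_large : LPi w (large w alpha x) i = value (w i) (x i) large_s.
Proof.
rewrite /value big_filter (perm_big _ perm_s) [RHS]big_mkcond.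
by apply: eq_bigr => t _; rewrite /large; case: ifP; rewrite ?mulr1 ?mulr0.
Qed.

Lemma mass_large_le : \sum_t large w alpha x i t <= e.
Proof.
rewrite mass_large; have := mass_filter_energy x01 s_sorted c_le l_le.
have m0 : 0 <= mass (x i) large_s by apply: mass_ge0.
rewrite -/large_s; set m := mass _ _ => H.
rewrite -(@ler_pXn2r _ 2) //.
have {}H : m ^+ 2 * (1 / 2%:R - e ^+ 3) <= 4%:R * e ^+ 3.
  rewrite -(ler_pM2l l_gt0); have := energy_s; move: H; rewrite /c; lra.
(* From [e <= 1/10]: the factor is at least 0.499 while [4 e^3 <= 0.4 e^2], whence [m^2 <= e^2]. *)
have : m ^+ 2 * (1 / 2%:R - 1 / 1000%:R) <= m ^+ 2 * (1 / 2%:R - e ^+ 3).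
  rewrite ler_wpM2l ?sqr_ge0 //.
  by have := e2_le; have := e3_le; have := e_le; lra.
have := e3_le; have := sqr_ge0 e; lra.
Qed.

Lemma value_large_le :
  LPi w (large w alpha x) i <= (1 / 2%:R + e) * l.
Proof.
rewrite value_large.
have := value_filter_le x01 (alpha * l) s_sorted s_capped; rewrite -/large_s.
have := mass_large_le; rewrite mass_large => m_le.
(* The large part is worth at most [c (1 + e)], and [e/2 + e^3 + e^4 <= e]. *)
have c0 : 0 <= c := capped_c_ge0 s_capped.
have := ler_wpM2l c0 m_le => cm H; apply: le_trans (_ : c * (1 + e) <= _).
  by lra.
rewrite /c mulrAC ler_wpM2r ?(ltW l_gt0) //.
have : e ^+ 3 * e <= e ^+ 3 * (1 / 10%:R) by rewrite ler_wpM2l ?exprn_ge0.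
have := e2_le; have := e3_le; have := e_ge0; lra.
Qed.

Let excess : R :=
  \sum_(t <- s | w i t <= alpha * l) Num.max 0 (w i t - c) * x i t.

Let excess_le' (eta : R) : 0 <= eta ->
  eta * excess <= 2%:R * e ^+ 3 * l + eta ^+ 2 * (alpha * l - c).
Proof.
move=> eta0; have c_le_al := le_trans c_le l_le.
have := excess_le (w i) x01 s eta0 c_le_al; rewrite -/excess.
have : Num.min (mass (x i) s) eta <= eta by rewrite ge_min lexx orbT.
have K0 : 0 <= eta * (alpha * l - c) by rewrite mulr_ge0 ?subr_ge0.
move/(ler_wpM2l K0); have := energy_s; lra.
Qed.

(* Take [eta = e]; when [e = 0] the bound holds for all small [eta > 0]. *)
Let excess_small : excess <= ((alpha + 2%:R) * e - e ^+ 3) * l.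
Proof.
have ll := l_le; have lg := l_gt0; have cl := c_le.
have al0 : 0 <= alpha * l by lra.
have c0 : 0 <= c := capped_c_ge0 s_capped.
have [e0|e_neq0] := eqVneq e 0.
  rewrite e0 mulr0 expr0n subrr mul0r.
  apply/ler_addgt0Pr => d d0; rewrite add0r.
  pose eta := d / (alpha * l).
  have al_gt0 : 0 < alpha * l by lra.
  have eta0 : 0 < eta by rewrite divr_gt0.
  have := excess_le' (ltW eta0); rewrite e0 expr0n mulr0 mul0r add0r expr2 -mulrA.
  rewrite ler_pM2l // => /le_trans; apply.
  apply: le_trans (_ : eta * (alpha * l) <= _); last by rewrite divfK ?gt_eqF.
  by rewrite ler_wpM2l ?(ltW eta0) //; lra.
have e_gt0 : 0 < e by rewrite lt_neqAle eq_sym e_neq0.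
rewrite -(ler_pM2l e_gt0); apply: le_trans (excess_le' e_ge0) _.
rewrite /c.
have : e ^+ 3 * l <= e ^+ 2 / 10%:R * l by rewrite ler_wpM2r ?(ltW l_gt0).
have : e ^+ 2 * (l * e ^+ 2) <= e ^+ 2 * (l * (1 / 100%:R)).
  rewrite ler_wpM2l ?sqr_ge0 // ler_wpM2l ?(ltW l_gt0) //.
  by have := e2_le; have := e_le; lra.
have := mulr_ge0 (sqr_ge0 e) (ltW l_gt0).
have := mulr_ge0 (exprn_ge0 5 e_ge0) (ltW l_gt0).
lra.
Qed.

(** The small part is worth at most [c + excess], since its mass is at most 1; the [e ^+ 3] in [c]
    cancels the one subtracted in [excess_small]. *)
Lemma value_large_ge :
  (1 / 2%:R - (alpha + 2%:R) * e) * l <= LPi w (large w alpha x) i.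
Proof.
have split_l : l = LPi w (large w alpha x) i +
    \sum_(t <- s | w i t <= alpha * l) w i t * x i t.
  rewrite value_large /value big_filter (perm_big _ perm_s) /=.
  rewrite [X in _ = _ + X](perm_big _ perm_s) /=.
  apply: (etrans (bigID (fun t => alpha * l < w i t) _ _)); congr (_ + _).
  by apply: eq_bigl => t; rewrite -leNgt.
have small_le : \sum_(t <- s | w i t <= alpha * l) w i t * x i t <= c + excess.
  apply: (@le_trans _ _ (\sum_(t <- s | w i t <= alpha * l)
      (c * x i t + Num.max 0 (w i t - c) * x i t))).
    apply: ler_sum => t _; rewrite -mulrDl ler_wpM2r //.
    by rewrite -lerBlDl le_max lexx orbT.
  rewrite big_split lerD2r /= -mulr_sumr ler_piMr ?(capped_c_ge0 s_capped) //.
  apply: le_trans x_sum; rewrite (perm_big _ perm_s) /=.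
  by rewrite [leRHS](bigID (fun t => w i t <= alpha * l)) /= lerDl sumr_ge0.
have := excess_small; rewrite /c in small_le *; lra.
Qed.

End OfflineVertex.

Theorem lemma4p2 (R : realType) (U V : finType)
    (w : U -> V -> R) (p : V -> R)
    (w_ge0 : forall i t, 0 <= w i t)
    (p_prob : forall t, 0 <= p t <= 1)
    (gamma alpha : R)
    (gamma_range : 0 <= gamma < 10%:R ^- 4)
    (alpha_ge1 : 1 <= alpha)
    (a : U -> V -> R)
    (a_in : in_polytope p a)
    (LB_small : LB w a <= (1 / 2%:R + gamma) * LP w a) :
  exists b : U -> V -> R,
    [/\ forall i t, 0 <= b i t,
        forall i t, b i t <= a i t,
        LP w b >= (1 - gamma `^ (1 / 4%:R)) * LP w a
      & forall i,
          [/\ \sum_t large w alpha b i t <= gamma `^ (1 / 4%:R),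
              (1 / 2%:R - (alpha + 2%:R) * gamma `^ (1 / 4%:R)) * LPi w b i
                <= LPi w (large w alpha b) i
            & LPi w (large w alpha b) i
                <= (1 / 2%:R + gamma `^ (1 / 4%:R)) * LPi w b i]].
Proof.
case: a_in => a_ge0 _ a_sum.
have /andP[g0 g_lt] := gamma_range.
set e := gamma `^ (1 / 4%:R).
have e0 : 0 <= e by apply: powR_ge0.
have e4 : e ^+ 4 = gamma.
  by rewrite -powR_mulrn // -powRrM mulrVK ?unitfE ?pnatr_eq0 // powRr1.
have e_le : e <= 1 / 10%:R.
  rewrite -(@ler_pXn2r _ 4) // ?nnegrE ?divr_ge0 // e4 div1r exprVn.
  exact: ltW.
pose good i := (0 < LPi w a i) && (LBi w a i <= (1 / 2%:R + e ^+ 3) * LPi w a i).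
pose b i t := if good i then a i t else 0.
have bE i : good i -> b i = a i by move=> gi; apply/funext => t; rewrite /b gi.
have b0 i : ~~ good i -> b i = fun=> 0.
  by move=> gi; apply/funext => t; rewrite /b (negbTE gi).
have LPb i : LPi w b i = if good i then LPi w a i else 0.
  rewrite /LPi; case: ifPn => gi; first by rewrite bE.
  by rewrite b0 // big1 // => t _; rewrite mulr0.
have l_ge0 i : 0 <= LPi w a i by apply: LPi_ge0.
exists b; split.
- by move=> i t; rewrite /b; case: ifP.
- by move=> i t; rewrite /b; case: ifP.
(* Markov's inequality: the [D i] are nonnegative with sum at most [e^4 LP(a)], and a discarded row
   of positive value has [D i > e^3 LPi]. *)
- pose D i := LBi w a i - LPi w a i / 2%:R.
  have D0 i : 0 <= D i.
    by rewrite subr_ge0; apply: half_LPi_le_LBi => //; apply: a_sum.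
  have sumD : \sum_i D i <= e ^+ 4 * LP w a.
    by move: LB_small; rewrite sumrB -mulr_suml e4 /LB /LP; lra.
  (* Dividing by [e^3] fails at [e = 0]; there every [D i] vanishes, so discarded rows have value
     zero. *)
  have [e_eq0|e_neq0] := eqVneq e 0.
    have Dz i : D i = 0.
      apply/eqP; rewrite eq_le D0 andbT; apply: le_trans (_ : \sum_j D j <= _).
        by rewrite (bigD1 i) //= lerDl sumr_ge0.
      by apply: le_trans sumD _; rewrite e_eq0 expr0n mul0r.
    rewrite e_eq0 subr0 mul1r /LP; apply: ler_sum => i _.
    rewrite LPb; case: ifPn => //; rewrite negb_and -leNgt => /orP[//|].
    by rewrite -ltNge e_eq0 expr0n addr0 => ?; have := Dz i; rewrite /D; lra.
  have e_gt0 : 0 < e by rewrite lt_neqAle eq_sym e_neq0.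
  rewrite mulrBl mul1r lerBlDr -lerBlDl.
  rewrite -(ler_pM2l (exprn_gt0 3 e_gt0)) mulrA -exprSr.
  apply: le_trans sumD; rewrite /LP -sumrB mulr_sumr; apply: ler_sum => i _.
  rewrite LPb; case: ifPn => [_|]; first by rewrite subrr mulr0.
  have e3 : 0 <= e ^+ 3 by apply: exprn_ge0.
  rewrite subr0 negb_and -leNgt -ltNge => /orP[l0|/ltW].
    by apply: le_trans (D0 i); apply: mulr_ge0_le0.
  by rewrite /D; lra.
move=> i; case: (boolP (good i)) => gi; last first.
  have lb0 t : large w alpha b i t = 0 by rewrite /large b0 // mul0r.
  rewrite LPb (negbTE gi) !mulr0 /LPi !big1 //.
  by move=> t _; rewrite lb0 mulr0.
(* The cutoff in [large] depends on row [i] only, so discarding other rows does not move it. *)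
have lbE : large w alpha b i = large w alpha a i.
  by apply/funext => t; rewrite /large LPb gi bE.
rewrite LPb gi /(LPi w (large w alpha b) i) lbE.
case/andP: gi => l_gt0 LB_le.
by split; [apply: mass_large_le | apply: value_large_ge | apply: value_large_le].
Qed.
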